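(* Let $p=p(n)\in[0,1]$ be a sequence of edge-probabilities satisfying $n^{-1}\ll p\ll (\log n)^{2/3}n^{-2/3}$. Then there exists a sequence of edge-probabilities $q=q(n)\in[0,1]$ with $p(n)\le q(n)\le 2p(n)$ such that the domination number $\gamma(G_{n,q})$ of $G_{n,q}$ is not concentrated on two values, in the sense that for infinitely many $n$ we have $$\max_{r\ge 0}\mathbb{P}\bigl(\gamma(G_{n,q})\in\{r,r+1\}\bigr)\le \tfrac34 ,$$ where the maximum is over integers $r\ge 0$.
   Context: $G_{n,q}$ denotes the binomial random graph on vertex set $[n]=\{1,\dots,n\}$ in which each of the $\binom n2$ possible edges is included independently with probability $q$. A dominating set of a graph $G$ is a set $K\subseteq V(G)$ such that every vertex $v\in V(G)\setminus K$ has at least one neighbor in $K$; the domination number $\gamma(G)$ is the smallest number of vertices of a dominating set of $G$. For sequences of positive reals, $a_n\ll b_n$ means $a_n/b_n\to 0$ as $n\to\infty$. *)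

(* Defs.v *)
From HB Require Import structures.
From mathcomp Require Import all_boot all_order all_algebra.
From mathcomp Require Import all_classical all_reals all_analysis.

Set Implicit Arguments.
Unset Strict Implicit.
Unset Printing Implicit Defensive.

Import Order.TTheory GRing.Theory Num.Theory.
Import numFieldNormedType.Exports.

Local Open Scope classical_set_scope.
Local Open Scope ring_scope.

(* A simple graph on the vertex set 'I_n is given by its edge set
   E \subset pairs n. *)
Definition pairs (n : nat) : {set {set 'I_n}} := [set e : {set 'I_n} | #|e| == 2]%SET.

Definition dominating (n : nat) (E : {set {set 'I_n}}) (K : {set 'I_n}) : bool :=
  [forall v in ~: K, exists u in K, [set u; v]%SET \in E].

(* The full vertex set is always dominating, so the minimum below is taken over
   a nonempty family. *)
Definition domination_number (n : nat) (E : {set {set 'I_n}}) : nat :=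
  #|[arg min_(K < [set: 'I_n]%SET | dominating E K) #|K|]%N|.

(* The law of the binomial random graph: the elements of pairs n are edges
   independently, each with probability q. *)
Definition Gnq_prob (R : realType) (n : nat) (q : R)
    (A : pred {set {set 'I_n}}) : R :=
  \sum_(E in powerset (pairs n) | A E)
    \prod_(e in pairs n) (if e \in E then q else 1 - q).

(* The relation is between sequences of positive reals; positivity is imposed
   only eventually ((log n)^(2/3) vanishes at n = 1), and it has to be explicit
   because x / 0 = 0. *)
Definition much_less (R : realType) (a b : nat -> R) : Prop :=
  (\forall n \near \oo, 0 < a n /\ 0 < b n) /\
  (a n / b n @[n --> \oo] --> (0 : R)).

(* Main.v *)
Require Import Defs.
From HB Require Import structures.
From mathcomp Require Import all_boot all_order all_algebra.
From mathcomp Require Import all_classical all_reals all_analysis.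
From mathcomp Require Import ring lra zify.

Set Implicit Arguments.
Unset Strict Implicit.
Unset Printing Implicit Defensive.

Import Order.TTheory GRing.Theory Num.Theory.
Import numFieldNormedType.Exports.

Local Open Scope ring_scope.

(** Suppose that the domination number is concentrated on two values for every
    q in [p, 2p]. Changing q by a small multiple of sqrt(p)/n changes all
    probabilities by at most 1/2 (the chi-square divergence of the two product
    laws is small), so two consecutive concentration intervals intersect, and
    over the O(n sqrt(p)) steps from p to 2p the interval moves by
    O(n sqrt(p)). With L = ln(np), a first moment bound shows that the
    domination number typically exceeds (3/4) L/p at p, while at 2p a fixed set
    of about L/(2p) vertices together with the vertices it fails to dominate is
    a dominating set of at most L/(2p) + O(1/p) vertices. The drop of order L/p
    is larger than O(n sqrt(p)) throughout the given range of p. *)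

(** * Product weights and the law of the random graph *)

(** Choosing one summand at each index gives one term per subset. Normalisation, avoidance of edges,
    inclusion-exclusion and the chi-square sum all rest on this expansion. *)
Lemma sum_powerset_prod (R : comNzRingType) (T : finType) (S : {set T})
    (f g : T -> R) :
  \sum_(E in powerset S) \prod_(e in S) (if e \in E then f e else g e)
  = \prod_(e in S) (f e + g e).
Proof.
(* Extending by 0 and by 1 outside [S] kills the terms of subsets not contained in [S] and leaves
   the other products unchanged. *)
pose F e := if e \in S then f e else 0.
pose G e := if e \in S then g e else 1.
transitivity (\prod_e (F e + G e)); last first.
  rewrite [RHS]big_mkcond /=; apply: eq_bigr => e _.
  by rewrite /F /G; case: ifP; rewrite ?add0r.
rewrite bigA_distr /= [LHS]big_mkcond /=; apply: eq_big => // E _.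
rewrite powersetE; case: ifPn => [/fintype.subsetP sES|].
  rewrite big_mkcond /=; apply: eq_bigr => e _; rewrite /F /G.
  by case: ifP; case: ifP => // eE; rewrite sES.
case/subsetPn => e eE eS; rewrite (bigD1 e) //= eE /F (negPf eS) mul0r //.
Qed.

Section Law.
Variables (R : realType) (n : nat) (q : R).
Implicit Types (A B : pred {set {set 'I_n}}) (E T : {set {set 'I_n}}).
Implicit Types (K J : {set 'I_n}).

Definition weight E : R := \prod_(e in pairs n) (if e \in E then q else 1 - q).

Lemma Gnq_probE A :
  Gnq_prob q A = \sum_(E in powerset (pairs n)) weight E * (A E)%:R.
Proof.
rewrite /Gnq_prob big_mkcondr /=; apply: eq_bigr => E _.
by rewrite -/(weight E); case: (A E); rewrite ?mulr1 ?mulr0.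
Qed.

Lemma sum_weight : \sum_(E in powerset (pairs n)) weight E = 1.
Proof.
by rewrite sum_powerset_prod big1 // => e _; rewrite addrC subrK.
Qed.

Lemma Gnq_prob_avoid T : T \subset pairs n ->
  Gnq_prob q (fun E => [disjoint T & E]) = (1 - q) ^+ #|T|.
Proof.
move=> sT; rewrite Gnq_probE.
(* Giving weight 0 to a present edge of [T] absorbs the indicator into the product. *)
transitivity (\sum_(E in powerset (pairs n)) \prod_(e in pairs n)
    (if e \in E then (if e \in T then 0 else q) else 1 - q)).
  apply: eq_bigr => E _; case: (boolP [disjoint T & E]) => [dTE|].
    rewrite mulr1; apply: eq_bigr => e _; case: ifP => // eE.
    by rewrite (disjointFl dTE eE).
  rewrite mulr0 -setI_eq0 => /set0Pn[e /setIP[eT eE]].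
  by rewrite (bigD1 e) ?(fintype.subsetP sT) //= eE eT mul0r.
rewrite sum_powerset_prod -prodr_const [RHS]big_mkcond [LHS]big_mkcond /=.
apply: eq_bigr => e _; case: (boolP (e \in T)) => [eT|_].
  by rewrite (fintype.subsetP sT _ eT) add0r.
by case: ifP => // _; rewrite addrC subrK.
Qed.

(** For disjoint [K] and [J], the complete bipartite graph between them; a graph avoids it exactly
    when no vertex of [J] has a neighbor in [K]. *)
Definition star K J : {set {set 'I_n}} :=
  [set [set u; v]%SET | u in K, v in J]%SET.

Lemma mem_star K J u v : u \in K -> v \in J -> [set u; v]%SET \in star K J.
Proof. by move=> uK vJ; apply/imset2P; exists u v. Qed.

Lemma star_pairs K J : [disjoint K & J] -> star K J \subset pairs n.
Proof.
move=> dKJ; apply/fintype.subsetP => _ /imset2P[u v uK vJ ->].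
rewrite inE cards2; case: (eqVneq u v) => // uv.
by rewrite -uv (disjointFr dKJ uK) in vJ.
Qed.

(** Disjointness makes the end in [K] and the end in [J] recoverable from the edge. *)
Lemma card_star K J : [disjoint K & J] -> #|star K J| = (#|K| * #|J|)%N.
Proof.
move=> dKJ; rewrite /star -cardsX curry_imset2X card_in_imset //.
move=> [u v] [u' v'] /setXP[/= uK vJ] /setXP[/= u'K v'J] /= /setP eq_uv.
have /esym := eq_uv u; have /esym := eq_uv v; rewrite !inE !eqxx orbT /=.
case/orP=> /eqP vE; first by rewrite vE (disjointFr dKJ u'K) in vJ.
case/orP=> /eqP uE; last by rewrite uE (disjointFl dKJ v'J) in uK.
by rewrite uE vE.
Qed.

Lemma dominatingE E K : dominating E K =
  [forall v in ~: K, ~~ [disjoint star K [set v]%SET & E]].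
Proof.
rewrite /dominating; apply: eq_forallb => v; case: (v \in ~: K) => //=.
rewrite -setI_eq0; apply/exists_inP/set0Pn => [[u uK uvE]|].
  by exists [set u; v]%SET; rewrite inE uvE andbT mem_star // inE.
case=> _ /setIP[/imset2P[u v' uK /set1P-> ->] uvE].
by exists u.
Qed.

(* Inclusion-exclusion over sets J of vertices required to be undominated. *)
Lemma Gnq_prob_dominating K :
  Gnq_prob q (fun E => dominating E K) = (1 - (1 - q) ^+ #|K|) ^+ (n - #|K|).
Proof.
have dKJ J : J \in powerset (~: K) -> [disjoint K & J].
  by rewrite powersetE -finset.disjoints_subset disjoint_sym.
have indicator E : (dominating E K)%:R =
    \sum_(J in powerset (~: K)) (-1) ^+ #|J| * [disjoint star K J & E]%:R :> R.
  (* One factor per outside vertex: it vanishes if the vertex is undominated and is 1 otherwise. *)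
  transitivity (\prod_(v in ~: K)
      (- [disjoint star K [set v]%SET & E]%:R + 1) : R).
    rewrite dominatingE; case: forall_inP => [dom|/forall_inP].
      rewrite big1 // => v vK; rewrite (negPf (dom v vK)).
      by rewrite oppr0 add0r.
    rewrite negb_forall_in => /exists_inP[v vK /negPn dv].
    by rewrite (bigD1 v) //= dv addNr mul0r.
  rewrite -sum_powerset_prod; apply: eq_bigr => J JK.
  have sJ : J \subset ~: K by rewrite -powersetE.
  rewrite -big_mkcondr /= (eq_bigl (mem J)); last first.
    move=> v /=; case: (boolP (v \in J)) => [vJ|]; rewrite ?andbF ?andbT //.
    by rewrite (fintype.subsetP sJ).
  rewrite prodrN; congr (_ * _).
  case: (boolP [disjoint star K J & E]) => [dJ|].
    rewrite big1 // => v vJ; rewrite (disjointWl _ dJ) //.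
    by apply: imset2S => //; rewrite finset.sub1set.
  rewrite -setI_eq0 => /set0Pn[_ /setIP[/imset2P[u v uK vJ ->] uvE]].
  rewrite (bigD1 v) //= -setI_eq0; case: eqP => [dv|]; last by rewrite mul0r.
  have : [set u; v]%SET \in (star K [set v]%SET :&: E)%SET.
    by rewrite inE uvE andbT mem_star // inE.
  by rewrite dv inE.
rewrite Gnq_probE.
under eq_bigr do rewrite indicator big_distrr /=.
rewrite exchange_big /=.
(* The term of [J] is $(-(1-q)^{|K|})^{|J|}$, so the alternating sum folds back into a product over
   the vertices outside [K]. *)
transitivity (\sum_(J in powerset (~: K)) \prod_(v in ~: K)
    (if v \in J then - (1 - q) ^+ #|K| else 1)).
  apply: eq_bigr => J JK; have sJ : J \subset ~: K by rewrite -powersetE.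
  under eq_bigr do rewrite mulrCA.
  rewrite -big_distrr /= -Gnq_probE Gnq_prob_avoid ?star_pairs ?dKJ //.
  rewrite card_star ?dKJ // -big_mkcondr /= (eq_bigl (mem J)); last first.
    move=> v /=; case: (boolP (v \in J)) => [vJ|]; rewrite ?andbF ?andbT //.
    by rewrite (fintype.subsetP sJ).
  by rewrite prodr_const [RHS]exprNn exprM.
rewrite sum_powerset_prod prodr_const [#|~: K|%SET]cardsCs finset.setCK.
by rewrite card_ord addrC.
Qed.

End Law.

(** * Deterministic facts on dominating sets *)

Section Domination.
Variables (n : nat) (E : {set {set 'I_n}}).
Implicit Types K : {set 'I_n}.

Lemma domination_number_le K : dominating E K -> (domination_number E <= #|K|)%N.
Proof.
rewrite /domination_number; case: arg_minnP => [|K0 _ minK0]; last exact: minK0.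
by apply/forall_inP => v; rewrite !inE.
Qed.

Lemma domination_number_witness :
  exists2 K, dominating E K & #|K| = domination_number E.
Proof.
rewrite /domination_number; case: arg_minnP => [|K domK _]; last by exists K.
by apply/forall_inP => v; rewrite !inE.
Qed.

Lemma dominatingS K K' : K \subset K' -> dominating E K -> dominating E K'.
Proof.
move=> sKK' /forall_inP domK; apply/forall_inP => v.
rewrite inE => vK'; have /domK/exists_inP[u uK uvE] : v \in ~: K.
  by rewrite inE; apply: contra vK'; apply: fintype.subsetP.
by apply/exists_inP; exists u => //; apply: (fintype.subsetP sKK').
Qed.

(** Adding vertices one at a time preserves domination, so a first moment bound need only count sets
    of size exactly [k]. *)
Lemma dominating_of_card k : (domination_number E <= k <= n)%N ->
  exists2 K, dominating E K & #|K| = k.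
Proof.
case/andP=> + kn; have [K domK <-] := domination_number_witness => Kk.
elim: k kn Kk => [_|k IHk kn].
  by rewrite leqn0 => /eqP K0; exists K.
rewrite leq_eqVlt => /predU1P[|Kk]; first by exists K.
have [K' domK' cK'] := IHk (ltnW kn) Kk.
have /set0Pn[v vK'] : ~: K' != finset.set0.
  by rewrite -card_gt0 cardsCs finset.setCK card_ord cK' subn_gt0.
exists (v |: K')%SET; first by apply: dominatingS domK'; apply: finset.subsetUr.
by rewrite inE in vK'; rewrite cardsU1 vK' cK'.
Qed.

Definition undominated K : {set 'I_n} :=
  [set v in ~: K | [disjoint star K [set v]%SET & E]]%SET.

(** Adding to [K] the vertices it misses produces a dominating set. *)
Lemma domination_number_le_undominated K :
  (domination_number E <= #|K| + #|undominated K|)%N.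
Proof.
apply: leq_trans (leq_card_setU _ _); apply: domination_number_le.
apply/forall_inP => v; rewrite !inE negb_or => /andP[vK]; rewrite vK /=.
rewrite -setI_eq0 => /set0Pn[_ /setIP[/imset2P[u v' uK /set1P-> ->] uvE]].
by apply/exists_inP; exists u => //; rewrite inE uK.
Qed.

End Domination.

(* Sum d^2/f >= 2 D d - D^2 f over A, where d = g - f and D is the sum of d
   over A. *)
Lemma chi_square (R : realFieldType) (T : finType) (S : {set T}) (A : pred T)
    (f g : T -> R) :
    (forall i, i \in S -> 0 < f i) ->
    \sum_(i in S) f i = 1 -> \sum_(i in S) g i = 1 ->
  (\sum_(i in S) g i * (A i)%:R - \sum_(i in S) f i * (A i)%:R) ^+ 2
  <= \sum_(i in S) g i ^+ 2 / f i - 1.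
Proof.
move=> f_gt0 f1 g1.
set D := \sum_(i in S) _ - _.
have DE : D = \sum_(i in S) (g i - f i) * (A i)%:R.
  by rewrite /D -sumrB; apply: eq_bigr => i _; rewrite mulrBl.
have -> : \sum_(i in S) g i ^+ 2 / f i - 1 =
    \sum_(i in S) (g i - f i) ^+ 2 / f i.
  transitivity (\sum_(i in S) (g i ^+ 2 / f i - 2 * g i + f i)).
    by rewrite big_split sumrB -mulr_sumr f1 g1 /=; ring.
  apply: eq_bigr => i /f_gt0 fi; field; exact: lt0r_neq0.
have PA : \sum_(i in S) f i * (A i)%:R <= 1.
  rewrite -[leRHS]f1; apply: ler_sum => i /f_gt0 fi.
  by case: (A i); rewrite /= ?mulr1 ?mulr0 // ltW.
have H : \sum_(i in S) (2 * D * ((g i - f i) * (A i)%:R)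
      - D ^+ 2 * (f i * (A i)%:R)) <= \sum_(i in S) (g i - f i) ^+ 2 / f i.
  apply: ler_sum => i /f_gt0 fi; case: (A i); rewrite /= ?mulr1 ?mulr0; last first.
    by rewrite subr0 divr_ge0 ?sqr_ge0 // ltW.
  rewrite ler_pdivlMr // -subr_ge0.
  have -> : (g i - f i) ^+ 2 - (2 * D * (g i - f i) - D ^+ 2 * f i) * f i
    = (g i - f i - D * f i) ^+ 2 by ring.
  exact: sqr_ge0.
(* The left side of [H] is $2D^2 - D^2 P$, where $P \le 1$ is the mass of [A] under [f]; hence it is
   at least $D^2$. *)
apply: le_trans H; rewrite sumrB -!mulr_sumr -DE.
have := sqr_ge0 D; rewrite expr2 => D2; nra.
Qed.

(** * Tail bounds for the domination number and comparison of nearby edge probabilities *)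

Section Probability.
Variables (R : realType) (n : nat).
Implicit Types (q : R) (A B : pred {set {set 'I_n}}).

Lemma weight_ge0 q (E : {set {set 'I_n}}) : 0 <= q <= 1 -> 0 <= weight q E.
Proof.
case/andP=> q0 q1; apply: prodr_ge0 => e _.
by case: ifP => // _; rewrite subr_ge0.
Qed.

Lemma le_Gnq_prob q A B : 0 <= q <= 1 -> (forall E, A E -> B E) ->
  Gnq_prob q A <= Gnq_prob q B.
Proof.
move=> q01 AB; rewrite !Gnq_probE; apply: ler_sum => E _.
rewrite ler_wpM2l ?weight_ge0 // ler_nat.
by have := AB E; case: (A E) => // ->.
Qed.

Lemma Gnq_probD_le1 q A B : 0 <= q <= 1 -> (forall E, A E -> ~~ B E) ->
  Gnq_prob q A + Gnq_prob q B <= 1.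
Proof.
move=> q01 AB; rewrite !Gnq_probE -[leRHS](sum_weight n q) -big_split /=.
apply: ler_sum => E _; rewrite -mulrDr ler_piMr ?weight_ge0 // -natrD lern1.
by have := AB E; case: (A E) => [/(_ isT)/negPf->|]; case: (B E).
Qed.

(** Union bound: the right side is the expected number of dominating sets of size [k]. *)
Lemma Gnq_prob_domination_number_le q k : 0 <= q <= 1 -> (k <= n)%N ->
  Gnq_prob q (fun E : {set {set 'I_n}} => (domination_number E <= k)%N)
  <= 'C(n, k)%:R * (1 - (1 - q) ^+ k) ^+ (n - k).
Proof.
move=> q01 kn.
have -> : 'C(n, k)%:R * (1 - (1 - q) ^+ k) ^+ (n - k) =
    \sum_(K : {set 'I_n} | #|K| == k) Gnq_prob q (fun E => dominating E K).
  under eq_bigr => K /eqP cK do rewrite Gnq_prob_dominating cK.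
  have <- : #|[set K : {set 'I_n} | #|K| == k]%SET| = 'C(n, k).
    by rewrite card_draws card_ord.
  rewrite sumr_const mulr_natl; congr (_ *+ _).
  by apply: eq_card => K; rewrite !inE.
under [leRHS]eq_bigr do rewrite Gnq_probE.
rewrite Gnq_probE exchange_big /=; apply: ler_sum => E _.
rewrite -mulr_sumr ler_wpM2l ?weight_ge0 //.
case: (boolP (_ <= _)%N) => [domk|_]; last by rewrite sumr_ge0.
have [|K domK /eqP cK] := @dominating_of_card _ E k; first by rewrite domk.
by rewrite (bigD1 K) //= domK lerDl sumr_ge0.
Qed.

(** Markov's inequality for the number of vertices undominated by one fixed set of size [k]. *)
Lemma Gnq_prob_domination_number_ge q k m : 0 <= q <= 1 -> (k <= n)%N ->
  m%:R * Gnq_prob q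
    (fun E : {set {set 'I_n}} => (k + m <= domination_number E)%N)
  <= n%:R * (1 - q) ^+ k.
Proof.
move=> q01 kn.
have [K /eqP cK] : exists K : {set 'I_n}, #|K| == k.
  have /card_gt0P[K] : (0 < #|[set K : {set 'I_n} | #|K| == k]%SET|)%N.
    by rewrite card_draws card_ord bin_gt0.
  by rewrite inE => cK; exists K.
have dKv v : v \in ~: K -> [disjoint K & [set v]%SET].
  by rewrite inE => vK; rewrite disjoint_sym disjoints1.
have EY : \sum_(E in powerset (pairs n)) weight q E * #|undominated E K|%:R
    = (n - k)%:R * (1 - q) ^+ k.
  transitivity (\sum_(v in ~: K) Gnq_prob q
      (fun E => [disjoint star K [set v]%SET & E])).
    under [RHS]eq_bigr do rewrite Gnq_probE.
    rewrite exchange_big /=; apply: eq_bigr => E _.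
    rewrite -mulr_sumr -natr_sum; congr (_ * _%:R).
    rewrite -sum1_card -big_mkcondr /=.
    by apply: eq_bigl => v; rewrite inE.
  rewrite (eq_bigr (fun=> (1 - q) ^+ k)).
    by rewrite sumr_const cardsCs finset.setCK card_ord cK mulr_natl.
  move=> v vK; rewrite Gnq_prob_avoid ?star_pairs ?dKv //.
  by rewrite card_star ?dKv // cards1 muln1 cK.
apply: (@le_trans _ _ ((n - k)%:R * (1 - q) ^+ k)); last first.
  by rewrite ler_wpM2r ?exprn_ge0 ?subr_ge0 ?ler_nat ?leq_subr //; case/andP: q01.
rewrite -EY Gnq_probE mulr_sumr; apply: ler_sum => E _.
rewrite mulrCA ler_wpM2l ?weight_ge0 // -natrM ler_nat.
case: (boolP (k + m <= _)%N) => [kmE|_]; last by rewrite /= muln0.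
rewrite /= muln1 -(leq_add2l k) (leq_trans kmE) // -cK.
exact: domination_number_le_undominated.
Qed.

(** The sum in [chi_square] factors over the edges, each contributing $q'^2/q + (1-q')^2/(1-q)$. *)
Lemma Gnq_prob_chi_square q q' A : 0 < q < 1 ->
  (Gnq_prob q' A - Gnq_prob q A) ^+ 2
  <= (1 + (q' - q) ^+ 2 / (q * (1 - q))) ^+ 'C(n, 2) - 1.
Proof.
case/andP=> q0 q1; have q1' : 0 < 1 - q by rewrite subr_gt0.
rewrite !Gnq_probE; apply: (le_trans (chi_square _ _ _ _)) => [E _| | |].
- by apply: prodr_gt0 => e _; case: ifP.
- exact: sum_weight.
- exact: sum_weight.
rewrite lerD2r le_eqVlt; apply/orP; left; apply/eqP.
transitivity (\sum_(E in powerset (pairs n)) \prod_(e in pairs n)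
    (if e \in E then q' ^+ 2 / q else (1 - q') ^+ 2 / (1 - q))).
  apply: eq_bigr => E _; rewrite -prodrXl -prodf_div; apply: eq_bigr => e _.
  by case: ifP.
rewrite sum_powerset_prod prodr_const card_draws card_ord; congr (_ ^+ _).
by field; rewrite !lt0r_neq0.
Qed.

(** Since $\binom n2 \le n^2/2$ and $1-q \ge 1/2$, the constant 5 makes the chi-square bound at most
    $e^{1/5} - 1 \le 1/4$, whose square root is 1/2. *)
Lemma Gnq_prob_close q q' A : 0 < q -> q <= 1 / 2 ->
    n%:R ^+ 2 * (q' - q) ^+ 2 <= q / 5 ->
  `|Gnq_prob q' A - Gnq_prob q A| <= 1 / 2.
Proof.
move=> q0 q2 close.
have q1 : 0 < q < 1 by apply/andP; split => //; lra.
have := Gnq_prob_chi_square q' A q1; set t := _ / (_ * _) => chi.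
have t0 : 0 <= t.
  by rewrite /t divr_ge0 ?sqr_ge0 // mulr_ge0; lra.
have bt : 'C(n, 2)%:R * t <= 1 / 5.
  have -> : 1 / 5 = (q * (1 - q) / 5) / (q * (1 - q)).
    by field; rewrite lt0r_neq0 //=; lra.
  rewrite /t mulrA ler_pM2r ?invr_gt0; last by nra.
  have b2 : 'C(n, 2)%:R * 2 <= n%:R ^+ 2 :> R.
    by rewrite -natrM -natrX ler_nat bin2 muln2 -[leqRHS]mulnn; lia.
  have := sqr_ge0 (q' - q); nra.
have e54 : (1 + t) ^+ 'C(n, 2) <= 5 / 4.
  apply: (@le_trans _ _ (expR (1 / 5))).
    apply: (@le_trans _ _ (expR t ^+ 'C(n, 2))).
      by rewrite lerXn2r ?nnegrE ?expR_ge1Dx ?expR_ge0 ?addr_ge0.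
    by rewrite -expRM_natl ler_expR.
  have : expR (1 / 5 : R) * expR (- (1 / 5)) = 1 by rewrite -expRD subrr expR0.
  have := expR_ge1Dx (- (1 / 5) : R); have := expR_gt0 (1 / 5 : R); nra.
rewrite ler_norml; apply/andP; split; nra.
Qed.

(** If $r \ge r'+2$, the two intervals are disjoint, so the one at [r'] has probability below 1/4 at
    [q] but above 3/4 at [q']. *)
Lemma concentration_interval_step q q' r r' :
    0 < q -> q <= 1 / 2 -> n%:R ^+ 2 * (q' - q) ^+ 2 <= q / 5 ->
    3 / 4 < Gnq_prob q (fun E : {set {set 'I_n}} =>
      (domination_number E == r) || (domination_number E == r.+1)) ->
    3 / 4 < Gnq_prob q' (fun E : {set {set 'I_n}} =>
      (domination_number E == r') || (domination_number E == r'.+1)) ->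
  (r <= r'.+1)%N.
Proof.
move=> q0 q2 close conc conc'; rewrite leqNgt; apply/negP => rr'.
have q01 : 0 <= q <= 1 by apply/andP; split; lra.
have := Gnq_prob_close (fun E : {set {set 'I_n}} =>
  (domination_number E == r') || (domination_number E == r'.+1)) q0 q2 close.
rewrite ler_norml => /andP[_].
have : Gnq_prob q (fun E : {set {set 'I_n}} =>
      (domination_number E == r) || (domination_number E == r.+1)) +
    Gnq_prob q (fun E : {set {set 'I_n}} =>
      (domination_number E == r') || (domination_number E == r'.+1)) <= 1.
  apply: Gnq_probD_le1 => // E.
  by case/orP=> /eqP ->; rewrite negb_or !neq_ltn; lia.
lra.
Qed.

End Probability.

(* Compare 'C(n, k) x^-k with the expansion of (1 + 1/x)^n. *)
Lemma bin_le_expR (R : realType) (n k : nat) (x : R) : 0 < x ->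
  'C(n, k)%:R <= expR (n%:R / x) * x ^+ k.
Proof.
move=> x0; have [nk|kn] := ltnP n k.
  by rewrite bin_small // mulr_ge0 ?expR_ge0 ?exprn_ge0 // ltW.
rewrite -ler_pdivrMr ?exprn_gt0 // expRM_natl.
apply: (@le_trans _ _ ((1 + x^-1) ^+ n)); last first.
  rewrite lerXn2r ?nnegrE ?expR_ge0 ?expR_ge1Dx //.
  by rewrite addr_ge0 ?invr_ge0 ?ltW.
have kn1 : (k < n.+1)%N by [].
rewrite exprDn (bigD1 (Ordinal kn1)) //= expr1n mul1r exprVn.
rewrite -[_ ^- _ *+ _]mulr_natl lerDl.
apply: sumr_ge0 => i _; rewrite expr1n mul1r mulrn_wge0 // exprn_ge0 //.
by rewrite invr_ge0 ltW.
Qed.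

(** * Bounds at the two ends of the window, and the walk between them *)

Section Window.
Variables (R : realType) (n : nat) (p : R).

Let L := ln (n%:R * p).

(** As [ln] is 0 at nonpositive arguments, a large [L] forces [n%:R * p] to be positive. *)
Lemma mean_degreeE : 10 ^+ 4 <= L -> n%:R * p = expR L.
Proof.
move=> np_large; rewrite lnK // posrE ltNge; apply/negP => /ln0 np0.
by move: np_large; rewrite /L np0; lra.
Qed.

(** There are at most $\exp((1 + \frac34 L^2)/p)$ candidate sets, while each dominates with
    probability at most $\exp(-e^{L/6}/(2p))$. *)
Lemma domination_number_lower : 0 < p -> p <= 1 / 100 -> 10 ^+ 4 <= L ->
  Gnq_prob p (fun E : {set {set 'I_n}} =>
    (domination_number E <= Num.trunc (3 / 4 * L / p))%N) < 3 / 4.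
Proof.
move=> p_gt0 p_small L_large; have npE := mean_degreeE L_large.
set k := Num.trunc _.
have kp : k%:R * p <= 3 / 4 * L.
  by rewrite -ler_pdivlMr // truncn_le divr_ge0 ?ltW //; lra.
have k0 : 0 <= k%:R :> R by [].
clearbody k.
have eL : 1 + L ^+ 2 / 2 <= expR L by apply: (@expR_ge1Dxn _ _ 1); lra.
have eL6 : 1 + (L / 6) ^+ 3 / 6 <= expR (L / 6).
  by apply: (@expR_ge1Dxn _ _ 2); lra.
have k2n : k%:R <= n%:R / 2 :> R.
  rewrite -(ler_pM2r p_gt0) (le_trans kp) // [leRHS]mulrAC npE.
  nra.
have kn : (k <= n)%N by rewrite -(ler_nat R); have := ler0n R n; lra.
have p01 : 0 <= p <= 1 by apply/andP; split; lra.
apply: (le_lt_trans (Gnq_prob_domination_number_le p01 kn)).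
set y := (1 - p) ^+ k.
(* Here $5/6 = (10/9)(3/4)$, and $e^{-10p/9} \le 1-p$ because $(1 + 10p/9)(1-p) \ge 1$ for $p \le
   1/10$. *)
have y_ge : expR (- (5 / 6 * L)) <= y.
  have p1 : expR (- (10 / 9 * p)) <= 1 - p.
    have : expR (10 / 9 * p) * expR (- (10 / 9 * p)) = 1.
      by rewrite -expRD subrr expR0.
    have := expR_ge1Dx (10 / 9 * p); have := expR_gt0 (- (10 / 9 * p)).
    set a := expR _; set b := expR _ => a0 b1 ba.
    have : (1 + 10 / 9 * p) * a <= 1 by rewrite -[leRHS]ba ler_pM2r.
    have : 1 <= (1 + 10 / 9 * p) * (1 - p) by nra.
    move=> h1 h2; have := le_trans h2 h1; rewrite ler_pM2l //; lra.
  apply: (@le_trans _ _ (expR (- (10 / 9 * p)) ^+ k)).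
    by rewrite -expRM_natl ler_expR; nra.
  by rewrite lerXn2r ?nnegrE ?expR_ge0 //; lra.
have y1 : y <= 1 by rewrite exprn_ile1 //; lra.
clearbody y.
have prob_dom : (1 - y) ^+ (n - k) <= expR (- (y * (n - k)%:R)).
  rewrite -mulNr expRM_natr lerXn2r ?nnegrE ?expR_ge0 ?subr_ge0 //.
  exact: expR_ge1Dx.
have choices : 'C(n, k)%:R <= expR (p^-1 + k%:R * L).
  have := @bin_le_expR R n k (expR L) (expR_gt0 L).
  rewrite -expRM_natl -expRD -npE.
  suff -> : n%:R / (n%:R * p) = p^-1 by [].
  rewrite invfM mulrA mulfV ?mul1r //.
  by apply: contraTneq (expR_gt0 L) => n0; rewrite -npE n0 mul0r ltxx.
apply: (@le_lt_trans _ _ (expR (-1))); last first.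
  have : expR (1 : R) * expR (-1) = 1 by rewrite -expRD subrr expR0.
  have := expR_ge1Dx (1 : R); have := expR_gt0 (-1 : R); nra.
apply: (@le_trans _ _
    (expR (p^-1 + k%:R * L) * expR (- (y * (n - k)%:R)))).
  by apply: ler_pM => //; rewrite exprn_ge0 // subr_ge0.
rewrite -expRD ler_expR natrB //.
have yn : expR (L / 6) / 2 <= y * (n%:R - k%:R) * p.
  apply: (@le_trans _ _ (y * (n%:R / 2) * p)); last first.
    rewrite ler_pM2r // ler_wpM2l //; last lra.
    by apply: le_trans y_ge; exact: expR_ge0.
  have -> : y * (n%:R / 2) * p = y * (n%:R * p) / 2 by field.
  rewrite npE ler_pM2r; last lra.
  have -> : L / 6 = - (5 / 6 * L) + L by field.
  by rewrite expRD ler_pM2r ?expR_gt0.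
(* The cubic bound [eL6] beats the quadratic term because $L \ge 10^4$. *)
have fin : 1 + 3 / 4 * L ^+ 2 + p <= expR (L / 6) / 2 by nra.
rewrite -(ler_pM2r p_gt0).
have -> : (p^-1 + k%:R * L - y * (n%:R - k%:R)) * p
  = 1 + k%:R * p * L - y * (n%:R - k%:R) * p.
  by field; exact: lt0r_neq0.
nra.
Qed.

(** More than $L/(2p)$ vertices leave on average at most $n e^{-L} = 1/p$ undominated; Markov's
    inequality is applied at a threshold above $2/p$. *)
Lemma domination_number_upper : 0 < p -> p <= 1 / 100 -> 10 ^+ 4 <= L ->
  Gnq_prob (2 * p) (fun E : {set {set 'I_n}} =>
    ((Num.trunc (L / (2 * p))).+1 + (Num.trunc (2 / p)).+1
      <= domination_number E)%N) < 3 / 4.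
Proof.
move=> p_gt0 p_small L_large; have npE := mean_degreeE L_large.
set k := (Num.trunc (L / _)).+1; set m := (Num.trunc _).+1.
have m2 : 2 < m%:R * p by rewrite -ltr_pdivrMr // truncnS_gt.
have kL : L < k%:R * (2 * p) by rewrite -ltr_pdivrMr ?truncnS_gt //; lra.
have kL' : k%:R * (2 * p) <= L + 2 * p.
  rewrite -ler_pdivlMr; last lra.
  rewrite mulrDl divff; last by rewrite lt0r_neq0 //; lra.
  by rewrite /k -natr1 lerD2r truncn_le divr_ge0; lra.
clearbody k m.
have eL : 1 + L ^+ 2 / 2 <= expR L by apply: (@expR_ge1Dxn _ _ 1); lra.
have kn : (k <= n)%N.
  rewrite -(ler_nat R) -(ler_pM2r p_gt0) npE; nra.
have p01 : 0 <= 2 * p <= 1 by apply/andP; split; lra.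
have := Gnq_prob_domination_number_ge m p01 kn.
set P := Gnq_prob _ _ => mP.
have avoid : (1 - 2 * p) ^+ k <= expR (- L).
  apply: (@le_trans _ _ (expR (- (2 * p)) ^+ k)).
    by rewrite lerXn2r ?nnegrE ?expR_ge0 ?expR_ge1Dx //; lra.
  by rewrite -expRM_natl ler_expR; lra.
have : m%:R * p * P <= 1.
  have npL : n%:R * p * expR (- L) = 1 by rewrite npE -expRD subrr expR0.
  rewrite -[leRHS]npL mulrAC [leRHS]mulrAC ler_pM2r // (le_trans mP) //.
  by rewrite ler_wpM2l.
rewrite ltNge => mpP; apply/negP => P34.
have : 2 * (3 / 4) <= m%:R * p * P by apply: ler_pM; lra.
lra.
Qed.

(** After scaling by [p], the required drop is about $L/4$, whereas the walk accounts for only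
    $3np\sqrt p \le L/8$ plus bounded terms. *)
Lemma exists_not_concentrated : 0 < p -> p <= 1 / 100 -> 10 ^+ 4 <= L ->
    n%:R * p * Num.sqrt p <= L / 24 ->
  exists2 q, p <= q <= 2 * p & forall r : nat,
    Gnq_prob q (fun E : {set {set 'I_n}} =>
      (domination_number E == r) || (domination_number E == r.+1)) <= 3 / 4.
Proof.
move=> p_gt0 p_small L_large np32_small.
pose concentrated (q : R) (r : nat) := 3 / 4 < Gnq_prob q (fun E : {set {set 'I_n}} =>
  (domination_number E == r) || (domination_number E == r.+1)).
apply: contrapT => none.
have conc q : p <= q <= 2 * p -> exists r, concentrated q r.
  move=> qp; apply: contrapT => nr; case: none; exists q => // r; rewrite leNgt; apply/negP => rc.
  by apply: nr; exists r.
pose s := Num.sqrt p.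
have s2 : s ^+ 2 = p by rewrite sqr_sqrtr // ltW.
have s0 : 0 <= s by rewrite sqrtr_ge0.
(* The step [p / M%:R] is then at most $\sqrt p/(3n)$ for positive [n], giving $p/9 \le p/5$ in the
   closeness condition. *)
pose M := (Num.trunc (3 * n%:R * s)).+1.
have ns0 : 0 <= 3 * n%:R * s by rewrite !mulr_ge0.
have M_lb : 3 * n%:R * s < M%:R by rewrite truncnS_gt.
have M_ub : M%:R <= 3 * n%:R * s + 1 by rewrite /M -natr1 lerD2r truncn_le.
have M0 : 0 < M%:R :> R by rewrite ltr0n.
pose q (i : nat) : R := p + i%:R * (p / M%:R).
have h0 : 0 < p / M%:R by rewrite divr_gt0.
have qp i : (i <= M)%N -> p <= q i <= 2 * p.
  move=> iM; have i0 : 0 <= i%:R :> R by [].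
  have : i%:R * (p / M%:R) <= p.
    by rewrite mulrCA ler_piMr ?(ltW p_gt0) // ler_pdivrMr // mul1r ler_nat.
  by rewrite /q => ?; apply/andP; split; nra.
have hM : p / M%:R * M%:R = p by rewrite divfK // lt0r_neq0.
have step : n%:R ^+ 2 * (p / M%:R) ^+ 2 <= p / 5.
  have M2 : 9 * n%:R ^+ 2 * p <= M%:R ^+ 2.
    rewrite -s2; have -> : 9 * n%:R ^+ 2 * s ^+ 2 = (3 * n%:R * s) ^+ 2 by ring.
    by rewrite lerXn2r ?nnegrE // ltW.
  rewrite expr_div_n mulrA ler_pdivrMr ?exprn_gt0 //.
  have := exprn_gt0 2 M0; nra.
have [r0 c0] : exists r, concentrated p r by apply: conc; apply/andP; split; lra.
(* The lower end of the interval falls by at most one per step. *)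
have walk i : (i <= M)%N -> exists2 r, concentrated (q i) r & (r0 <= r + i)%N.
  elim: i => [_|i IHi iM].
    by exists r0; rewrite ?addn0 // /q mul0r addr0.
  have [r cr r0r] := IHi (ltnW iM).
  have [r' cr'] := conc _ (qp _ iM).
  exists r' => //; apply: (leq_trans r0r); rewrite addnS -addSn leq_add2r.
  have /andP[pq q2p] := qp _ (ltnW iM).
  apply: (@concentration_interval_step R n (q i) (q i.+1)) cr cr'; try lra.
  have -> : q i.+1 - q i = p / M%:R by rewrite /q -natr1; ring.
  lra.
have [r cr r0r] := walk M (leqnn M).
have qM : q M = 2 * p by rewrite /q mulrC hM; ring.
have p01 : 0 <= p <= 1 by apply/andP; split; lra.
have pp01 : 0 <= 2 * p <= 1 by apply/andP; split; lra.
have r0_lb : 3 / 4 * L / p < r0.+1%:R.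
  apply: (lt_le_trans (truncnS_gt _)); rewrite ler_nat ltnS leqNgt.
  apply/negP => r0k; have := domination_number_lower p_gt0 p_small L_large; apply/negP; rewrite -leNgt.
  apply: (le_trans (ltW c0)); apply: le_Gnq_prob => // E.
  by case/orP => /eqP ->; rewrite // ltnW.
have r_ub : (r < (Num.trunc (L / (2 * p))).+1 + (Num.trunc (2 / p)).+1)%N.
  rewrite ltnNge; apply/negP => rk; have := domination_number_upper p_gt0 p_small L_large.
  apply/negP; rewrite -leNgt; rewrite qM in cr.
  apply: (le_trans (ltW cr)); apply: le_Gnq_prob => // E.
  case/orP => /eqP ->; [exact: rk | exact: leqW rk].
have : r0.+1%:R * p <= (L / (2 * p) + 1 + (2 / p + 1) + (3 * n%:R * s + 1)) * p.
  rewrite ler_pM2r //.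
  apply: (@le_trans _ _ (r.+1 + M)%:R); first by rewrite ler_nat addSn ltnS.
  rewrite natrD lerD //.
  apply: (@le_trans _ _ ((Num.trunc (L / (2 * p))).+1 + (Num.trunc (2 / p)).+1)%:R).
    by rewrite ler_nat.
  by rewrite natrD lerD // -[X in X <= _]natr1 lerD2r truncn_le divr_ge0; lra.
have -> : (L / (2 * p) + 1 + (2 / p + 1) + (3 * n%:R * s + 1)) * p
    = L / 2 + 2 + 3 * p + 3 * (n%:R * p * s).
  by field; exact: lt0r_neq0.
move: r0_lb; rewrite ltr_pdivrMr //.
have := np32_small; rewrite -/s; lra.
Qed.

End Window.

(** * The range of [p] and the choice of the sequence [q] *)

(** The hypothesis on [p], cubed, bounds $p^3x^2 = (xp\sqrt p)^2$ by a small multiple of $(\ln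
    x)^2$; what remains is to replace $\ln x$ by $\ln(xp)$. *)
Lemma upper_range_bounds (R : realType) (x p : R) :
    1 <= x -> 0 < p ->
    p < 1 / 100 * (ln x `^ (2 / 3) * x `^ (- (2 / 3))) -> 10 ^+ 4 <= ln (x * p) ->
  p <= 1 / 100 /\ x * p * Num.sqrt p <= ln (x * p) / 24.
Proof.
move=> x1 p0; set b := _ * _ `^ _ => pb; set L := ln _ => L_large.
have x0 : 0 < x by lra.
have b0 : 0 <= b by rewrite mulr_ge0 ?powR_ge0.
have lnx0 : 0 <= ln x by exact: ln_ge0.
have b3 : b ^+ 3 * x ^+ 2 = ln x ^+ 2.
  rewrite /b exprMn -!powR_mulrn ?powR_ge0 ?ln_ge0 // -?powRrM; try lra.
  have -> : 2 / 3 * 3 = 2 :> R by field.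
  have -> : - (2 / 3) * 3 = - 2 :> R by field.
  rewrite -mulrA powRN mulVf ?mulr1 // powR_mulrn ?expf_neq0 ?lt0r_neq0 //.
  exact: ltW.
clearbody b.
have lnx : ln x <= x.
  by have := expR_ge1Dx (ln x); rewrite lnK ?posrE //; lra.
have b1 : b <= 1.
  rewrite -(expr_le1 (isT : (0 < 3)%N) b0) -(ler_pM2r (exprn_gt0 2 x0)) b3 mul1r.
  by rewrite lerXn2r ?nnegrE // ltW.
split; first lra.
have p3 : p ^+ 3 * x ^+ 2 <= ln x ^+ 2 / 100 ^+ 3.
  rewrite -b3 [leRHS]mulrAC ler_pM2r ?exprn_gt0 // -expr_div_n.
  by rewrite lerXn2r ?nnegrE; lra.
have sqE : (x * p * Num.sqrt p) ^+ 2 = p ^+ 3 * x ^+ 2.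
  by rewrite exprMn sqr_sqrtr ?ltW //; ring.
have : (x * p * Num.sqrt p) ^+ 2 <= (L / 24) ^+ 2.
  rewrite sqE; have [lt1|ge1] := ltP (p ^+ 3 * x ^+ 2) 1.
    by apply: (le_trans (ltW lt1)); rewrite exprn_ege1 //; lra.
  (* Here x <= (x p)^3, so the logarithms of x and x p are comparable. *)
  have lnL : ln x <= 3 * L.
    rewrite mulr_natl -lnXn ?mulr_gt0 // ler_ln ?posrE ?exprn_gt0 ?mulr_gt0 //.
    have -> : (x * p) ^+ 3 = x * (p ^+ 3 * x ^+ 2) by ring.
    by rewrite ler_pMr.
  apply: (le_trans p3).
  have : ln x ^+ 2 <= (3 * L) ^+ 2 by rewrite lerXn2r ?nnegrE; lra.
  have -> : (3 * L) ^+ 2 = 9 * L ^+ 2 by ring.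
  have -> : (L / 24) ^+ 2 = L ^+ 2 / 576 by field.
  by have := sqr_ge0 L; lra.
by rewrite ler_sqr ?nnegrE ?mulr_ge0 ?sqrtr_ge0 ?(ltW x0) ?(ltW p0) //; lra.
Qed.

Theorem lemma1 (R : realType) (p : nat -> R)
    (p01 : forall n : nat, 0 <= p n <= 1)
    (p_lower : much_less (fun n => n%:R^-1) p)
    (p_upper : much_less p
       (fun n => (ln n%:R) `^ (2 / 3) * n%:R `^ (- (2 / 3)))) :
  exists q : nat -> R,
    (forall n : nat, 0 <= q n <= 1) /\
    (forall n : nat, p n <= q n <= 2 * p n) /\
    (forall N : nat, exists n : nat, (N <= n)%N /\
       forall r : nat,
         Gnq_prob (q n)
           (fun E : {set {set 'I_n}} =>
              (domination_number E == r) || (domination_number E == r.+1))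
         <= 3 / 4).
Proof.
pose spread n (q : R) := forall r, Gnq_prob q (fun E : {set {set 'I_n}} =>
  (domination_number E == r) || (domination_number E == r.+1)) <= 3 / 4.
(* Non-concentration holds for all large [n], more than infinitely often. *)
have [N0 _ large] : (\forall n \near \oo,
    exists q, [/\ 0 <= q <= 1, p n <= q <= 2 * p n & spread n q])%classic.
  case: p_lower => [pos1 lim1]; case: p_upper => [pos2 lim2].
  near=> n.
  have [n0 p0] : 0 < n%:R^-1 :> R /\ 0 < p n by near: n.
  have [_ b0] : 0 < p n /\ 0 < ln n%:R `^ (2 / 3) * n%:R `^ (- (2 / 3)) :> R.
    by near: n.
  rewrite invr_gt0 in n0.
  (* This says $np > e^{10^4}$, the source of [L_large]. *)
  have np : n%:R^-1 / p n < expR (- 10 ^+ 4).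
    by near: n; apply: (cvgr_lt _ lim1); exact: expR_gt0.
  have pb : p n / (ln n%:R `^ (2 / 3) * n%:R `^ (- (2 / 3))) < 1 / 100.
    by near: n; apply: (cvgr_lt _ lim2); lra.
  rewrite ltr_pdivrMr // in pb.
  have L_large : 10 ^+ 4 <= ln (n%:R * p n).
    rewrite -ler_expR lnK ?posrE ?mulr_gt0 // ltW //.
    by rewrite -ltf_pV2 ?posrE ?expR_gt0 ?mulr_gt0 // invfM -expRN.
  have [|p_small np32] := upper_range_bounds _ p0 pb L_large.
    by rewrite ler1n -(ltr0n R).
  have [q pq qspread] := exists_not_concentrated p0 p_small L_large np32.
  exists q; split => //; case/andP: pq => pq q2p.
  by apply/andP; split; lra.
(* Below [N0] the value [p n] itself serves, since it is nonnegative. *)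
have pick_q n : exists q, [/\ 0 <= q <= 1, p n <= q <= 2 * p n
    & (N0 <= n)%N -> spread n q].
  have [/large[q [q01 pq qspread]]|nN0] := leqP N0 n; first by exists q.
  have /andP[p0 p1] := p01 n.
  by exists (p n); split=> //; apply/andP; split; lra.
have [q qP] := choice pick_q.
exists q; split=> [n|]; first by have [] := qP n.
split=> [n|N]; first by have [] := qP n.
exists (maxn N0 N); split; first exact: leq_maxr.
by have [_ _] := qP (maxn N0 N); apply; exact: leq_maxl.
Unshelve. all: by end_near.
Qed.
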